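(* Consider a sequence of monomials $\boldsymbol{p}=(p_n)_{n\ge1}$ with $p_n(z)=a_n z^{d_n}$, $a_n\in\mathbb{C}\setminus\{0\}$ and integers $d_n\ge1$, and assume that $d_n\ge2$ for infinitely many $n$. Set $$D_n := \prod_{i=1}^n d_i,\quad A_n := \prod_{i=1}^n a_i^{D_n/D_i}\quad\text{and}\quad s_n := \frac{1}{D_n}\log|A_n| = \sum_{i=1}^n \frac{1}{D_i}\log|a_i|,$$ and let $S$ be the set of accumulation points of the sequence $(s_n)_{n\ge1}$ in $\overline{\mathbb{R}}:=\mathbb{R}\cup\{\pm\infty\}$. Then $$\mathscr{J}(\boldsymbol{p}) = \bigcup_{s\in S}\{z\in\hat{\mathbb{C}} : |z|=e^{-s}\}$$ with the conventions $e^{-\infty}=0$ and $e^{-(-\infty)}=+\infty$.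
   Context: $\hat{\mathbb{C}}=\mathbb{C}\cup\{\infty\}$ is the Riemann sphere with the spherical metric $\sigma$, and $|\infty|:=+\infty$. For a sequence $\boldsymbol{f}=(f_n)_{n\ge1}$ of rational maps of $\hat{\mathbb{C}}$, put $F^{(n)}_{\boldsymbol{f}}:=f_n\circ\dots\circ f_1$. The Fatou set $\mathscr{F}(\boldsymbol{f})$ is the largest open subset of $\hat{\mathbb{C}}$ on which the family $\{F^{(n)}_{\boldsymbol{f}} : n\ge1\}$ is normal (every sequence in the family has a subsequence converging locally uniformly, with respect to $\sigma$, to a holomorphic map into $\hat{\mathbb{C}}$), and the Julia set is $\mathscr{J}(\boldsymbol{f}):=\hat{\mathbb{C}}\setminus\mathscr{F}(\boldsymbol{f})$. Accumulation points of a real sequence in $\overline{\mathbb{R}}$ are the limits in $\overline{\mathbb{R}}$ of its subsequences. *)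

(* Defs.v *)
From HB Require Import structures.
From mathcomp Require Import all_boot all_order all_algebra.
From mathcomp Require Import complex.
From mathcomp Require Import all_classical all_reals all_analysis.

Set Implicit Arguments.
Unset Strict Implicit.
Unset Printing Implicit Defensive.

Import Order.TTheory GRing.Theory Num.Theory.
Import numFieldNormedType.Exports.
Import ComplexField.Normc.

Local Open Scope classical_set_scope.
Local Open Scope ring_scope.

(* All sequences of maps, coefficients and degrees below are indexed by the
   integers n >= 1; the value at index 0 is never used. *)

Section Sphere.
Context {R : realType}.

(* [Some z] is the finite point z and [None] is the point at infinity. *)
Definition sphere : Type := option R[i].

Definition modulus (p : sphere) : \bar R :=
  if p is Some z then (normc z)%:E else +oo%E.

(* The geodesic distance of the metric 2|dz|/(1+|z|^2): an arc of angle t on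
   the unit sphere has a chord of length 2 sin(t/2), and the chord between the
   stereographic images of z and w has length
   2|z-w| / sqrt((1+|z|^2)(1+|w|^2)). *)
Definition sigma (p q : sphere) : R :=
  match p, q with
  | Some z, Some w =>
      2 * asin (normc (z - w) /
                Num.sqrt ((1 + normc z ^+ 2) * (1 + normc w ^+ 2)))
  | Some z, None | None, Some z => 2 * asin (Num.sqrt (1 + normc z ^+ 2))^-1
  | None, None => 0
  end.

Definition sphere_open (U : set sphere) : Prop :=
  forall p, U p -> exists2 e : R, 0 < e & forall q, sigma p q < e -> U q.

Definition sphere_continuous_at (h : sphere -> sphere) (p : sphere) : Prop :=
  forall e : R, 0 < e ->
    exists2 r : R, 0 < r & forall q, sigma p q < r -> sigma (h p) (h q) < e.

Definition sphere_inv (p : sphere) : sphere :=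
  match p with
  | Some z => if z == 0 then None else Some z^-1
  | None => Some 0
  end.

(* [chart_at p] is the standard chart around p: the identity if p is finite
   and z |-> 1/z if p is infinite. Its value at the single point outside its
   domain is the junk value 0. *)
Definition chart_at (p q : sphere) : R[i] :=
  odflt 0 (if p is None then sphere_inv q else q).

Definition chart_inv (p : sphere) (z : R[i]) : sphere :=
  if p is None then sphere_inv (Some z) else Some z.

(* [derivable] is taken over the field R[i], i.e., it is complex
   differentiability. Continuity at p makes the junk value of
   [chart_at (h p)] irrelevant: near p, h stays in the domain of the chart. *)
Definition holomorphic_on (U : set sphere) (h : sphere -> sphere) : Prop :=
  forall p, U p ->
    sphere_continuous_at h p /\
    derivable
      ((fun z => chart_at (h p) (h (chart_inv p z))) : R[i]^o -> R[i]^o)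
      (chart_at p p) 1.

Definition cvg_locally_uniformly_on (U : set sphere)
    (g : nat -> sphere -> sphere) (h : sphere -> sphere) : Prop :=
  forall p, U p -> exists2 r : R, 0 < r &
    forall e : R, 0 < e -> exists N : nat, forall k, (N <= k)%N ->
      forall q, U q -> sigma p q < r -> sigma (g k q) (h q) < e.

Definition strictly_increasing (phi : nat -> nat) : Prop :=
  {homo phi : m n / (m < n)%N}.

Definition normal_on (U : set sphere) (G : set (sphere -> sphere)) : Prop :=
  forall g : nat -> sphere -> sphere, (forall k, G (g k)) ->
    exists phi h, [/\ strictly_increasing phi, holomorphic_on U h &
      cvg_locally_uniformly_on U (fun k => g (phi k)) h].

Fixpoint composition (f : nat -> sphere -> sphere) (n : nat)
    : sphere -> sphere :=
  if n is m.+1 then f m.+1 \o composition f m else id.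

Definition composition_family (f : nat -> sphere -> sphere)
    : set (sphere -> sphere) :=
  [set composition f n | n in [set n | (1 <= n)%N]].

Definition is_fatou_set (f : nat -> sphere -> sphere) (F : set sphere)
    : Prop :=
  [/\ sphere_open F, normal_on F (composition_family f) &
    forall U, sphere_open U -> normal_on U (composition_family f) ->
      U `<=` F].

Definition is_julia_set (f : nat -> sphere -> sphere) (J : set sphere)
    : Prop := is_fatou_set f (~` J).

Lemma is_julia_set_unique f J1 J2 :
  is_julia_set f J1 -> is_julia_set f J2 -> J1 = J2.
Proof.
move=> [open1 norm1 max1] [open2 norm2 max2]; apply: setC_inj.
by apply/seteqP; split; [exact: max2|exact: max1].
Qed.

Definition accumulation_points (u : nat -> R) : set (\bar R) :=
  [set l | exists2 phi : nat -> nat, strictly_increasing phi &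
     (u (phi k))%:E @[k --> \oo] --> l].

End Sphere.
Arguments sphere : clear implicits.

Section Monomials.
Context {R : realType}.

(* The value at infinity is the right one for a != 0 and d >= 1. *)
Definition monomial (a : R[i]) (d : nat) (p : sphere R) : sphere R :=
  if p is Some z then Some (a * z ^+ d) else None.

Definition Dprod (d : nat -> nat) (n : nat) : nat :=
  (\prod_(1 <= i < n.+1) d i)%N.

Definition Aprod (a : nat -> R[i]) (d : nat -> nat) (n : nat) : R[i] :=
  \prod_(1 <= i < n.+1) a i ^+ (Dprod d n %/ Dprod d i)%N.

Definition slog (a : nat -> R[i]) (d : nat -> nat) (n : nat) : R :=
  (Dprod d n)%:R^-1 * ln (normc (Aprod a d n)).

Lemma slogE (a : nat -> R[i]) (d : nat -> nat) (n : nat) :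
  (forall i, (1 <= i)%N -> a i != 0) -> (forall i, (1 <= i)%N -> (1 <= d i)%N) ->
  slog a d n = \sum_(1 <= i < n.+1) (Dprod d i)%:R^-1 * ln (normc (a i)).
Proof.
move=> a0 d1.
have Dgt0 m : (0 < Dprod d m)%N.
  by rewrite /Dprod big_nat; apply: prodn_cond_gt0 => i /andP[/d1].
have normc_gt0 (z : R[i]) : z != 0 -> 0 < normc z.
  move=> z0; rewrite lt0r; apply/andP; split.
    by apply: contra_neq z0 => /eq0_normc.
  by case: (z) => x y; rewrite /= sqrtr_ge0.
have dvdD i : (i < n.+1)%N -> (Dprod d i %| Dprod d n)%N.
  move=> lein; rewrite /Dprod [X in (_ %| X)%N](@big_cat_nat _ _ _ i.+1)//=.
  exact: dvdn_mulr.
have normcX (z : R[i]) k : normc (z ^+ k) = normc z ^+ k.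
  by elim: k => [|k IH]; rewrite ?expr0 ?normc1// !exprS normcM IH.
have lnP (r : seq nat) (F : nat -> R[i]) : {in r, forall i, F i != 0} ->
    ln (normc (\prod_(i <- r) F i)) = \sum_(i <- r) ln (normc (F i)).
  elim: r => [|i r IH] F0; first by rewrite !big_nil normc1 ln1.
  have Fr : {in r, forall i, F i != 0}.
    by move=> j jr; apply: F0; rewrite inE jr orbT.
  rewrite !big_cons normcM lnM ?IH// posrE; apply: normc_gt0.
    by apply: F0; rewrite mem_head.
  by rewrite prodf_seq_neq0; apply/allP => j /Fr ->.
rewrite /slog /Aprod lnP; last first.
  by move=> i; rewrite mem_index_iota => /andP[/a0 ai _]; rewrite expf_neq0.
rewrite big_distrr /= !big_nat; apply: eq_bigr => i /andP[i1 /dvdD iD].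
rewrite normcX lnXn ?normc_gt0 ?a0// -[ln _ *+ _]mulr_natl mulrA; congr (_ * _).
have neq0 m : (Dprod d m)%:R != 0 :> R by rewrite pnatr_eq0 -lt0n.
apply: (mulfI (neq0 n)); rewrite mulrA divff// mul1r.
apply: (mulIf (neq0 i)); rewrite -natrM divnK// -mulrA mulVf ?mulr1//.
Qed.

End Monomials.

(* Main.v *)
(* Put L(z) = -log|z|, with L(0) = +oo and L(oo) = -oo. The composition F_n is
   z |-> A_n z^{D_n}, so L(F_n(z)) = D_n (L(z) - s_n), and the claim is that the
   Julia set is L^{-1}(S). As D_n -> oo, along a subsequence with s_n -> s the
   maps converge locally uniformly to 0 where L > s and to oo where L < s. This
   gives normality off L^{-1}(S); near a point with L = s a limit would take
   both values 0 and oo, so it is not continuous. The inversion z |-> 1/z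
   preserves the spherical distance and changes the signs of L and of s_n, so
   statements about oo follow from those about 0. *)
Require Import Defs.
From HB Require Import structures.
From mathcomp Require Import all_boot all_order all_algebra.
From mathcomp Require Import complex ring lra.
From mathcomp Require Import all_classical all_reals all_analysis.

Set Implicit Arguments.
Unset Strict Implicit.
Unset Printing Implicit Defensive.

Import Order.TTheory GRing.Theory Num.Theory.
Import numFieldNormedType.Exports.
Import ComplexField.Normc.

Local Open Scope classical_set_scope.
Local Open Scope ring_scope.

#[local] Arguments normc {R} x : simpl never.

(** * The modulus on [R[i]] and its neighbourhoods *)

Section Normc.
Context {R : realType}.
Implicit Types z w : R[i].

Lemma normc_ge0 z : 0 <= normc z.
Proof. by case: z => x y; rewrite /= sqrtr_ge0. Qed.

Lemma normc_eq0 z : (normc z == 0) = (z == 0).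
Proof.
by apply/eqP/eqP => [/eq0_normc//|->]; rewrite normc0.
Qed.

Lemma normc_gt0 z : (0 < normc z) = (z != 0).
Proof. by rewrite lt0r normc_ge0 andbT normc_eq0. Qed.

Lemma normc_distC z w : normc (z - w) = normc (w - z).
Proof. by rewrite -normcN; congr normc; rewrite -[RHS]opprB. Qed.

Lemma normcX z n : normc (z ^+ n) = normc z ^+ n.
Proof.
by elim: n => [|n IH]; rewrite ?expr0 ?normc1// !exprS normcM IH.
Qed.

Lemma normc_triangle z w : normc w <= normc z + normc (z - w).
Proof.
rewrite [X in normc X](_ : w = z + (w - z)); last by rewrite addrC subrK.
by rewrite normc_distC; exact: le_normcD.
Qed.

Lemma normc_real (x : R) : normc x%:C%C = `|x|.
Proof. by rewrite /normc/= expr0n addr0 sqrtr_sqr. Qed.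

Lemma norm_normc z : `|z| = (normc z)%:C%C.
Proof. by []. Qed.

(** The norm of [R[i]] takes its values in [R[i]], so balls have complex radii; a positive complex
    number is real, which brings the radius down to [R]. *)
Lemma nbhs_normc z (V : set R[i]) :
  nbhs (z : R[i]^o) V <->
  exists2 e : R, 0 < e & forall w, normc (z - w) < e -> V w.
Proof.
split.
  move=> /nbhs_ballP[e /= e0 eV].
  have eE : e = (complex.Re e)%:C%C.
    by case: e e0 {eV} => x y; rewrite ltcE /= => /andP[/eqP -> _].
  exists (complex.Re e); first by move: e0; rewrite eE ltcR.
  move=> w zw; apply: eV; rewrite /ball /= norm_normc eE ltcR//.
move=> [e e0 eV]; apply/nbhs_ballP; exists e%:C%C; rewrite /= ?ltcR//.
by move=> w; rewrite /ball /= norm_normc ltcR => /eV.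
Qed.

End Normc.

(** * The spherical distance compared with the chordal and Euclidean ones *)

Section Sphere.
Context {R : realType}.
Implicit Types (z w : R[i]) (p q : sphere R).

(* Half the chordal distance, so that [sigma p q = 2 * asin (chord p q)]. *)
Definition chord (p q : sphere R) : R :=
  match p, q with
  | Some z, Some w =>
      normc (z - w) / Num.sqrt ((1 + normc z ^+ 2) * (1 + normc w ^+ 2))
  | Some z, None | None, Some z => (Num.sqrt (1 + normc z ^+ 2))^-1
  | None, None => 0
  end.

Lemma sqrt_1D_gt0 (x : R) : 0 < Num.sqrt (1 + x ^+ 2).
Proof. by rewrite sqrtr_gt0 ltr_wpDr// sqr_ge0. Qed.

Lemma sqrt_1D_ge1 (x : R) : 1 <= Num.sqrt (1 + x ^+ 2).
Proof. by rewrite -[leLHS]sqrtr1 ler_wsqrtr// lerDl sqr_ge0. Qed.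

Lemma sqrt_1D_le (x : R) : 0 <= x -> Num.sqrt (1 + x ^+ 2) <= 1 + x.
Proof.
move=> x0; rewrite -[leRHS]ger0_norm ?addr_ge0// -sqrtr_sqr ler_wsqrtr//.
nra.
Qed.

Lemma sqrt_1DV (x : R) : 0 < x ->
  Num.sqrt (1 + x^-1 ^+ 2) = Num.sqrt (1 + x ^+ 2) / x.
Proof.
move=> x0.
have -> : 1 + x^-1 ^+ 2 = (1 + x ^+ 2) * x^-1 ^+ 2 by field; rewrite gt_eqF.
by rewrite sqrtrM ?addr_ge0 ?sqr_ge0// sqrtr_sqr ger0_norm// invr_ge0 ltW.
Qed.

Lemma chord_ge0 p q : 0 <= chord p q.
Proof.
case: p q => [z|] [w|] //=; rewrite ?invr_ge0 ?sqrtr_ge0//.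
by rewrite divr_ge0 ?normc_ge0 ?sqrtr_ge0.
Qed.

Lemma chord_le1 p q : chord p q <= 1.
Proof.
case: p q => [z|] [w|] //=; rewrite ?invf_le1 ?sqrt_1D_gt0 ?sqrt_1D_ge1//.
have h x : 0 < 1 + normc x ^+ 2 :> R by rewrite ltr_wpDr// sqr_ge0.
rewrite ler_pdivrMr ?sqrtr_gt0 ?mulr_gt0// mul1r.
rewrite -[leLHS]ger0_norm ?normc_ge0// -sqrtr_sqr ler_wsqrtr//.
have := normc_triangle w z; have := normc_triangle z w.
have := normc_ge0 z; have := normc_ge0 w; have := normc_ge0 (z - w).
have : normc (z - w) <= normc z + normc w by rewrite -(normcN w) le_normcD.
move: (normc z) (normc w) (normc (z - w)) => x y t *.
(* The second comparison rests on (1 + x^2)(1 + y^2) - (x + y)^2 = (1 - xy)^2. *)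
apply: (@le_trans _ _ ((x + y) ^+ 2)); first by rewrite lerXn2r ?nnegrE ?addr_ge0.
have : 0 <= (1 - x * y) ^+ 2 by rewrite sqr_ge0.
by nra.
Qed.

Lemma asin0 : asin 0 = 0 :> R.
Proof. by rewrite -{1}(@sin0 R) sinK// in_itv /= oppr_le0 divr_ge0 ?pi_ge0. Qed.

Lemma sigmaE p q : sigma p q = 2 * asin (chord p q).
Proof.
by case: p q => [z|] [w|] //=; rewrite asin0 mulr0.
Qed.

Lemma asin_ge0 (x : R) : 0 <= x <= 1 -> 0 <= asin x.
Proof.
move=> /andP[x0 x1].
have xI : -1 <= x <= 1 by rewrite x1 (le_trans _ x0)// oppr_le0.
rewrite leNgt; apply/negP => a0.
have : 0 <= sin (- asin x).
  rewrite sin_ge0_pi// oppr_ge0 (ltW a0)/=.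
  have := asin_geNpi2 xI; have := pi_ge0 R; lra.
rewrite sinN asinK ?in_itv//= oppr_ge0 => x0'.
by move: a0; rewrite (_ : x = 0) ?asin0 ?ltxx//; apply/eqP; rewrite eq_le x0'.
Qed.

(** This is continuity of [asin] at 0. Together with [chord_lt], which uses [sin] in the same way,
    it makes small [sigma] and small [chord] interchangeable, uniformly in the points. *)
Lemma sigma_lt (e : R) : 0 < e ->
  exists2 r : R, 0 < r & forall p q, chord p q < r -> sigma p q < e.
Proof.
move=> e0; have : {for 0, continuous (@asin R)}.
  by apply: continuous_asin; rewrite ltrN10 ltr01.
move=> /cvgr_dist_lt /(_ (e / 2)); rewrite divr_gt0// => /(_ isT).
rewrite asin0 => /nbhs_ballP[r /= r0 rP]; exists r => // p q pq.
have := rP (chord p q); rewrite /ball /= !sub0r !normrN ger0_norm ?chord_ge0//.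
move=> /(_ pq); rewrite sigmaE ger0_norm; first by lra.
by rewrite asin_ge0 ?chord_ge0 ?chord_le1.
Qed.

Lemma chord_lt (e : R) : 0 < e ->
  exists2 r : R, 0 < r & forall p q, sigma p q < r -> chord p q < e.
Proof.
move=> e0; have /cvgr_dist_lt /(_ e e0) : {for 0, continuous (@sin R)}.
  exact: continuous_sin.
rewrite sin0 => /nbhs_ballP[r /= r0 rP]; exists (2 * r); first by lra.
move=> p q; rewrite sigmaE => pq.
have c1 := chord_le1 p q; have c0 := chord_ge0 p q.
have := rP (asin (chord p q)); rewrite /ball /= !sub0r !normrN.
rewrite ger0_norm ?asin_ge0 ?c0// asinK; last first.
  by rewrite in_itv/= c1 (le_trans _ c0)// lerN10.
by rewrite ger0_norm//; apply; lra.
Qed.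

Lemma sigma_refl p : sigma p p = 0.
Proof.
rewrite sigmaE (_ : chord p p = 0) ?asin0 ?mulr0//.
by case: p => [z|//] /=; rewrite subrr normc0 mul0r.
Qed.

Lemma sigma_sym p q : sigma p q = sigma q p.
Proof.
rewrite !sigmaE; congr (2 * asin _).
by case: p q => [z|] [w|] //=; rewrite normc_distC [X in Num.sqrt X]mulrC.
Qed.

Lemma sphere_invK : involutive (@sphere_inv R).
Proof.
case=> [z|] /=; last by rewrite eqxx.
case: eqP => [->//|/eqP z0] /=; by rewrite invr_eq0 (negbTE z0) invrK.
Qed.

(** For finite nonzero z and w, 1/z - 1/w = (w - z)/(zw), and the factor 1/(|z||w|) cancels against
    the square roots by [sqrt_1DV]. *)
Lemma sigma_inv p q : sigma (sphere_inv p) (sphere_inv q) = sigma p q.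
Proof.
rewrite !sigmaE; congr (2 * asin _).
have infV z : z != 0 ->
    (Num.sqrt (1 + normc z^-1 ^+ 2))^-1 =
    normc z / Num.sqrt (1 + normc z ^+ 2).
  by rewrite -normc_gt0 => z0; rewrite normcV sqrt_1DV// invf_div.
have chord0 z : normc z / Num.sqrt (1 + normc z ^+ 2) = chord (Some 0) (Some z).
  by rewrite /= normc_distC subr0 normc0 expr0n addr0 mul1r.
have chord00 : (Num.sqrt (1 + normc (0 : R[i]) ^+ 2))^-1 = 1.
  by rewrite normc0 expr0n addr0 sqrtr1 invr1.
case: p q => [z|] [w|] //=; last by rewrite subrr normc0 mul0r.
- case: (eqVneq z 0) => [->|z0]; case: (eqVneq w 0) => [->|w0] /=.
  + by rewrite subrr normc0 mul0r.
  + by rewrite infV// chord0.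
  + by rewrite infV// chord0 /= normc_distC [X in Num.sqrt X]mulrC.
  have nz0 : 0 < normc z by rewrite normc_gt0.
  have nw0 : 0 < normc w by rewrite normc_gt0.
  have -> : z^-1 - w^-1 = (w - z) * (z^-1 * w^-1).
    by field; rewrite z0 w0.
  rewrite !normcM !normcV normc_distC !sqrtrM ?addr_ge0 ?sqr_ge0//.
  rewrite !sqrt_1DV//.
  have := sqrt_1D_gt0 (normc z); have := sqrt_1D_gt0 (normc w).
  move: (Num.sqrt _) (Num.sqrt _) => u v u0 v0.
  by field; rewrite !gt_eqF.
- case: (eqVneq z 0) => [->|z0] /=; first by rewrite chord00.
  rewrite subr0 normc0 expr0n addr0 mulr1 normcV sqrt_1DV ?normc_gt0//.
  by field; rewrite !gt_eqF ?sqrt_1D_gt0 ?normc_gt0.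
- case: (eqVneq w 0) => [->|w0] /=; first by rewrite chord00.
  rewrite normc_distC subr0 normc0 expr0n addr0 mul1r normcV sqrt_1DV ?normc_gt0//.
  by field; rewrite !gt_eqF ?sqrt_1D_gt0 ?normc_gt0.
Qed.

(** The denominator in [chord] is at least 1, so [chord] is at most |z - w|. *)
Lemma sigma_fin_lt z (e : R) : 0 < e ->
  exists2 r : R, 0 < r &
    forall w, normc (z - w) < r -> sigma (Some z) (Some w) < e.
Proof.
move=> /sigma_lt[r r0 rP]; exists r => // w zw; apply: rP => /=.
rewrite (le_lt_trans _ zw)// ler_pdivrMr; last first.
  by rewrite sqrtrM ?mulr_gt0 ?sqrt_1D_gt0// addr_ge0 ?sqr_ge0.
rewrite ler_peMr ?normc_ge0// sqrtrM ?addr_ge0 ?sqr_ge0//.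
by rewrite mulr_ege1 ?sqrt_1D_ge1.
Qed.

Lemma sigma_fin_near z (e : R) : 0 < e ->
  exists2 r : R, 0 < r &
    forall q, sigma (Some z) q < r -> exists2 w, q = Some w & normc (z - w) < e.
Proof.
move=> e0; have z0 := normc_ge0 z.
pose C := 1 + normc z; have C1 : 1 <= C by rewrite /C lerDl.
have C0 : 0 < C by lra.
have ee : 0 < 1 + e by lra.
(* Call this constant d and put x = |z - w|. A chord below d gives x < dC(C + x). Since dC <= 1/2,
   the term in x is absorbed and x < 2dC^2 = e/(1 + e) < e. The same bound on dC excludes infinity,
   whose chord to z is at least 1/C. *)
have d0 : 0 < e / (2 * C ^+ 2 * (1 + e)).
  by rewrite divr_gt0// !mulr_gt0// ?exprn_gt0.
have [r r0 rP] := chord_lt d0; exists r => // q /rP {rP} /=.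
set d := e / _ in d0 *.
have dC : d * (2 * C ^+ 2 * (1 + e)) = e.
  by rewrite divfK// gt_eqF// !mulr_gt0// ?exprn_gt0.
have szC : Num.sqrt (1 + normc z ^+ 2) <= C by exact: sqrt_1D_le.
have sz1 := sqrt_1D_gt0 (normc z).
have dC2 : d * C * 2 <= 1.
  rewrite leNgt; apply/negP => dC2.
  have : C * (1 + e) < d * C * 2 * (C * (1 + e)) by rewrite ltr_pMl ?mulr_gt0.
  by nra.
case: q => [w|]; last first.
  rewrite invf_plt ?posrE// => h.
  have : d^-1 < C by exact: lt_le_trans szC.
  rewrite invf_plt ?posrE// => Cd.
  have : C^-1 * C < d * C by rewrite ltr_pM2r.
  by rewrite mulVf ?gt_eqF//; lra.
rewrite ltr_pdivrMr; last first.
  by rewrite sqrtrM ?mulr_gt0 ?sqrt_1D_gt0// addr_ge0 ?sqr_ge0.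
rewrite sqrtrM ?addr_ge0 ?sqr_ge0// => h; exists w => //.
have sw : Num.sqrt (1 + normc w ^+ 2) <= C + normc (z - w).
  apply: le_trans (sqrt_1D_le (normc_ge0 w)) _.
  by rewrite /C -addrA lerD2l normc_triangle.
have : normc (z - w) < d * (C * (C + normc (z - w))).
  apply: lt_le_trans h _; rewrite ler_wpM2l ?(ltW d0)//.
  by rewrite ler_pM ?sqrtr_ge0.
have := normc_ge0 (z - w); move: (normc (z - w)) => x x0 h'.
have xu : x < 2 * (d * C ^+ 2).
  have : d * C * 2 * x <= x by rewrite ler_piMl.
  by move: h'; rewrite expr2; lra.
have : 0 < d * C ^+ 2 by rewrite mulr_gt0 ?exprn_gt0.
have : 2 * (d * C ^+ 2) * (1 + e) = e by rewrite -[RHS]dC; ring.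
by move: (d * C ^+ 2) xu => u *; nra.
Qed.

End Sphere.

(** * The function -log|z| on the sphere and its continuity *)

Section NegLog.
Context {R : realType}.
Implicit Types (z w : R[i]) (p q : sphere R).

Definition neglog p : \bar R := (- lne (modulus p))%E.

Lemma neglog0 : neglog (Some 0) = +oo%E.
Proof. by rewrite /neglog /= normc0 lexx. Qed.

Lemma neglog_neq0 z : z != 0 -> neglog (Some z) = (- ln (normc z))%:E.
Proof. by rewrite -normc_gt0 /neglog /= => z0; rewrite leNgt z0. Qed.

(** Turns the circles of the theorem into level sets of [neglog], the degenerate cases s = +oo and s
    = -oo included. *)
Lemma modulus_expeR p (s : \bar R) : modulus p = expeR (- s)%E <-> s = neglog p.
Proof.
rewrite /neglog; split=> [->|->]; first by rewrite expeRK oppeK.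
rewrite oppeK; apply/esym/eqP; rewrite lneK_eq.
by case: p => [z|] /=; rewrite ?leey ?lee_fin ?normc_ge0.
Qed.

Lemma neglog_inv p : neglog (sphere_inv p) = (- neglog p)%E.
Proof.
case: p => [z|] /=; last by rewrite neglog0.
case: eqVneq => [->|z0]; first by rewrite neglog0.
by rewrite !neglog_neq0 ?invr_eq0// normcV lnV ?posrE ?normc_gt0.
Qed.

Lemma neglog_eqy p : neglog p = +oo%E -> p = Some 0.
Proof.
case: p => [z|//]; case: (eqVneq z 0) => [->//|z0].
by rewrite neglog_neq0.
Qed.

Lemma neglog_eqNy p : neglog p = -oo%E -> p = None.
Proof.
case: p => [z|//]; case: (eqVneq z 0) => [->|z0]; first by rewrite neglog0.
by rewrite neglog_neq0.
Qed.

Lemma neglog_gt_fin (c : R) z :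
  (c%:E < neglog (Some z))%E = (normc z < expR (- c)).
Proof.
have [->|z0] := eqVneq z 0; first by rewrite neglog0 ltry normc0 expR_gt0.
rewrite neglog_neq0// lte_fin ltrNr -[in RHS](@lnK _ (normc z)) ?ltr_expR//.
by rewrite posrE normc_gt0.
Qed.

(** The set where [neglog] exceeds c is a Euclidean disc around 0, and [sigma_fin_near] fits a
    spherical ball into it. *)
Lemma neglog_gt_near p (c : R) : (c%:E < neglog p)%E ->
  exists2 r : R, 0 < r & forall q, sigma p q < r -> (c%:E < neglog q)%E.
Proof.
case: p => [z|//]; rewrite neglog_gt_fin => zc.
have e0 : 0 < expR (- c) - normc z by rewrite subr_gt0.
have [r r0 rP] := sigma_fin_near z e0; exists r => // q /rP[w -> zw].
by rewrite neglog_gt_fin; have := normc_triangle z w; lra.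
Qed.

Lemma neglog_lt_near p (c : R) : (neglog p < c%:E)%E ->
  exists2 r : R, 0 < r & forall q, sigma p q < r -> (neglog q < c%:E)%E.
Proof.
rewrite -lteN2 -neglog_inv -EFinN => /neglog_gt_near[r r0 rP].
exists r => // q; rewrite -sigma_inv => /rP.
by rewrite neglog_inv EFinN lteN2.
Qed.

Lemma sigma0_lt (e : R) : 0 < e ->
  exists K : R, forall q, (K%:E < neglog q)%E -> sigma (Some 0) q < e.
Proof.
move=> /(sigma_fin_lt 0)[r r0 rP]; exists (- ln r) => -[z|//].
rewrite neglog_gt_fin opprK lnK ?posrE// => zr; apply: rP.
by rewrite normc_distC subr0.
Qed.

Lemma neglog_continuous p (V : set (\bar R)) : nbhs (neglog p) V ->
  exists2 r : R, 0 < r & forall q, sigma p q < r -> V (neglog q).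
Proof.
case E : (neglog p) => [l| |].
- move=> /nbhs_EFin /nbhs_ballP[e /= e0 eV].
  have [|r1 r10 r1P] := @neglog_gt_near p (l - e).
    by rewrite E lte_fin gtrBl.
  have [|r2 r20 r2P] := @neglog_lt_near p (l + e).
    by rewrite E lte_fin ltrDl.
  exists (Num.min r1 r2); first by rewrite lt_min r10.
  move=> q; rewrite lt_min => /andP[/r1P + /r2P].
  case: (neglog q) => [x| |]//.
  rewrite !lte_fin => h1 h2; apply: eV.
  by rewrite /ball /= ltr_distl; apply/andP; split; lra.
- move=> [M [_ MV]]; have [|r r0 rP] := @neglog_gt_near p M.
    by rewrite E ltry.
  by exists r => // q /rP /MV.
- move=> [M [_ MV]]; have [|r r0 rP] := @neglog_lt_near p M.
    by rewrite E ltNyr.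
  by exists r => // q /rP /MV.
Qed.

Lemma exists_neglog_lt p (r : R) : 0 < r -> neglog p != -oo%E ->
  exists2 q, sigma p q < r & (neglog q < neglog p)%E.
Proof.
case: p => [z|//] r0 _; have [e e0 eP] := sigma_fin_lt z r0.
have [z0|z0] := eqVneq z 0.
  exists (Some (e / 2)%:C%C).
    by apply: eP; rewrite normc_distC z0 subr0 normc_real ger0_norm; lra.
  rewrite z0 neglog0 neglog_neq0 ?ltry// -normc_gt0 normc_real.
  by rewrite normr_gt0; lra.
have nz : 0 < normc z by rewrite normc_gt0.
(* Multiplying z by 1 + t moves it radially outwards by t|z| = e/2. *)
pose t := e / 2 / normc z; have t0 : 0 < t by rewrite !divr_gt0.
have nt : normc (1 + t%:C%C) = 1 + t.
  have -> : 1 + t%:C%C = (1 + t)%:C%C by rewrite [RHS]rmorphD.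
  by rewrite normc_real ger0_norm//; lra.
have zt0 : z * (1 + t%:C%C) != 0.
  by rewrite -normc_gt0 normcM nt mulr_gt0//; lra.
exists (Some (z * (1 + t%:C%C))).
  apply: eP; rewrite normc_distC mulrDr mulr1 addrC addKr normcM normc_real.
  by rewrite gtr0_norm// mulrC divfK ?gt_eqF//; lra.
rewrite !neglog_neq0// lte_fin ltrN2 normcM nt ltr_ln ?posrE ?mulr_gt0//.
  by rewrite ltr_pMr//; lra.
by lra.
Qed.

Lemma exists_neglog_gt p (r : R) : 0 < r -> neglog p != +oo%E ->
  exists2 q, sigma p q < r & (neglog p < neglog q)%E.
Proof.
move=> r0 py; have [|q] := @exists_neglog_lt (sphere_inv p) _ r0.
  by rewrite neglog_inv eqe_oppLR.
move=> pq; exists (sphere_inv q).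
  by rewrite -sigma_inv sphere_invK.
by rewrite neglog_inv lteNr -neglog_inv.
Qed.

End NegLog.

(** * Subsequences and accumulation points in the extended reals *)

Section Sequences.
Context {R : realType}.

(** The choice function maps (k, N) to a suitable index at least N; starting each search just beyond
    the previous index makes [phi] strictly increasing. *)
Lemma extract_subsequence (P : nat -> nat -> Prop) :
  (forall k N, exists2 n, (N <= n)%N & P k n) ->
  exists2 phi, strictly_increasing phi & forall k, P k (phi k).
Proof.
move=> H; have /choice[f fP] : forall kN : nat * nat,
    exists n, (kN.2 <= n)%N /\ P kN.1 n.
  by move=> [k N]; have [n Nn Pn] := H k N; exists n.
pose phi := fix phi k := if k is j.+1 then f (k, (phi j).+1) else f (0, 0)%N.
exists phi; last by case=> [|k]; [exact: (fP (_, _)).2|exact: (fP (_, _)).2].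
by apply: homo_ltn; [exact: ltn_trans|move=> k; exact: (fP (_, _)).1].
Qed.

Lemma strictly_increasing_ge (phi : nat -> nat) : strictly_increasing phi ->
  forall k, (k <= phi k)%N.
Proof.
by move=> phiS; elim=> // k IH; apply: leq_ltn_trans IH (phiS _ _ _).
Qed.

(** The cluster point form has a usable negation: a neighbourhood that the sequence eventually
    avoids. Conversely, a subsequence is extracted from the balls of radius 1/(k+1) around l. *)
Lemma accumulation_pointsP (u : nat -> R) (l : \bar R) :
  accumulation_points u l <-> forall V, nbhs l V ->
    forall N, exists2 n, (N <= n)%N & V (u n)%:E.
Proof.
split=> [[phi phiS ul] V /ul [N _ NV] M|H].
  exists (phi (maxn M N)).
    exact: leq_trans (leq_maxl _ _) (strictly_increasing_ge phiS _).
  by apply: NV; rewrite /= leq_maxr.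
have [k N|phi phiS phiP] :=
    @extract_subsequence (fun k n => ball l k.+1%:R^-1 (u n)%:E).
  by apply: H; apply/nbhs_ballP; exists k.+1%:R^-1 => //=.
exists phi => //; apply/cvg_ballP => e e0.
near=> k; apply: le_ball (phiP k).
rewrite ltW//; near: k; exact: (near_infty_natSinv_lt (PosNum e0)).
Unshelve. all: by end_near.
Qed.

(** The map [contract] carries the extended reals onto the compact interval [-1, 1], and balls of
    [\bar R] are defined through it; [expand] takes a cluster point back. *)
Lemma ereal_bolzano_weierstrass (v : nat -> \bar R) :
  exists (phi : nat -> nat) (l : \bar R),
    strictly_increasing phi /\ v (phi k) @[k --> \oo] --> l.
Proof.
have FP : ProperFilter ((@contract R \o v) x @[x --> \oo]).
  exact: fmap_proper_filter.
have [|c [/= c1 cP]] := @segment_compact R (-1) 1 _ FP.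
  by exists 0%N => // n _ /=; rewrite in_itv /= -ler_norml contract_le1.
have cE : contract (expand c) = c.
  by apply: expandK; rewrite inE ler_norml; move: c1; rewrite in_itv.
have [k N|phi phiS phiP] := @extract_subsequence
    (fun k n => ball (expand c) k.+1%:R^-1 (v n)).
  have [||x [/= [n /= Nn <-]]] :=
      cP [set @contract R (v n) | n in [set n | (N <= n)%N]] (ball c k.+1%:R^-1).
  - by exists N => // n /= Nn; exists n.
  - exact: nbhsx_ballx.
  - by move=> vn; exists n => //; rewrite /ball /= /ereal_ball cE.
exists phi, (expand c); split => //; apply/cvg_ballP => e e0.
near=> k; apply: le_ball (phiP k).
rewrite ltW//; near: k; exact: (near_infty_natSinv_lt (PosNum e0)).
Unshelve. all: by end_near.
Qed.

Lemma ereal_dense (x y : \bar R) : (x < y)%E ->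
  exists2 c : R, (x < c%:E)%E & (c%:E < y)%E.
Proof.
case: x => [x| |]; case: y => [y| |]//.
- rewrite lte_fin => xy; exists ((x + y) / 2); rewrite lte_fin; lra.
- by move=> _; exists (x + 1); rewrite ?ltry// lte_fin ltrDl.
- by move=> _; exists (y - 1); rewrite ?ltNyr// lte_fin gtrBl.
- by move=> _; exists 0; rewrite ?ltNyr ?ltry.
Qed.

End Sequences.

(** * Holomorphy of monomials and of locally constant maps *)

Section Holomorphy.
Context {R : realType}.
Implicit Types (z w A : R[i]) (p q : sphere R) (U : set (sphere R)).

Lemma chart_near p (r : R) : 0 < r ->
  \forall z \near (chart_at p p : R[i]^o), sigma p (chart_inv p z) < r.
Proof.
move=> r0; apply/nbhs_normc; case: p => [z|] /=.
  exact: sigma_fin_lt.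
have [e e0 eP] := sigma_fin_lt 0 r0; exists e => // z /eP.
by rewrite -sigma_inv /chart_inv /= eqxx.
Qed.

(** Serves for the limit maps with values 0 and infinity: read in charts, such a map agrees near the
    point with a constant. *)
Lemma holomorphic_locally_constant U (h : sphere R -> sphere R) :
  (forall p, U p -> exists2 r : R, 0 < r &
    forall q, sigma p q < r -> h q = h p) ->
  holomorphic_on U h.
Proof.
move=> H p /H[r r0 rP]; split=> [e e0|].
  by exists r => // q /rP ->; rewrite sigma_refl.
apply: (@near_eq_derivable _ _ _ (cst (chart_at (h p) (h p)) : R[i]^o -> R[i]^o)).
  by near do [move=> /=; rewrite [h (chart_inv _ _)]rP//]; exact: chart_near.
exact: derivable_cst.
Unshelve. all: by end_near.
Qed.

Lemma monomial0 A n : (0 < n)%N -> monomial A n (Some 0) = Some 0.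
Proof. by move=> n0; rewrite /monomial expr0n gtn_eqF// mulr0. Qed.

Lemma monomial_inv A n p : A != 0 -> (0 < n)%N ->
  sphere_inv (monomial A n p) = monomial A^-1 n (sphere_inv p).
Proof.
move=> A0 n0; case: p => [z|] /=; last by rewrite expr0n gtn_eqF// mulr0.
have [->|z0] := eqVneq z 0; first by rewrite expr0n gtn_eqF// mulr0 eqxx.
by rewrite mulf_eq0 expf_eq0 (negbTE A0) (negbTE z0) andbF /= invfM exprVn.
Qed.

Lemma derivable_monomial A n z :
  derivable ((fun z => A * z ^+ n) : R[i]^o -> R[i]^o) z 1.
Proof.
by apply: derivableM; [exact: derivable_cst|exact: exprn_derivable].
Qed.

Lemma monomial_continuous A n p : A != 0 -> (0 < n)%N ->
  sphere_continuous_at (monomial A n) p.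
Proof.
(* The coefficient B is arbitrary because infinity will be reduced to the origin, where the
   inversion replaces A by its inverse. *)
move=> + n0; have fin B z : sphere_continuous_at (monomial B n) (Some z).
  move=> e e0; have [r r0 rP] := sigma_fin_lt (B * z ^+ n) e0.
  have /derivable1_diffP/differentiable_continuous := @derivable_monomial B n z.
  have /nbhs_normc rB : exists2 e : R, 0 < e &
      forall w, normc (B * z ^+ n - w) < e -> normc (B * z ^+ n - w) < r.
    by exists r.
  move=> /(_ _ rB) /nbhs_normc[d d0 dP].
  have [d' d'0 d'P] := sigma_fin_near z d0; exists d' => // q /d'P[w -> zw].
  by apply: rP; exact: dP.
move=> A0; case: p => [z|]; first exact: fin.
move=> e /(fin A^-1 0)[r r0 rP]; exists r => // q.
rewrite -sigma_inv -[X in _ -> X < _]sigma_inv !monomial_inv// /=.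
by rewrite expr0n gtn_eqF// mulr0; move=> /rP /=; rewrite expr0n gtn_eqF// mulr0.
Qed.

Lemma holomorphic_monomial U A n : A != 0 -> (0 < n)%N ->
  holomorphic_on U (monomial A n).
Proof.
move=> A0 n0 p _; split; first exact: monomial_continuous.
case: p => [z|]; first exact: derivable_monomial.
(* In the charts at infinity the map is again a monomial, and this holds for every z, not only near
   0. *)
rewrite (_ : (fun _ => _) = (fun z => A^-1 * z ^+ n)).
  exact: derivable_monomial.
by apply/funext => z; rewrite /chart_at monomial_inv// sphere_invK.
Qed.

End Holomorphy.

(** * Locally uniform convergence of monomials to 0 or infinity *)

Section Dynamics.
Context {R : realType}.
Implicit Types (A : R[i]) (p q : sphere R).

(** The value of -log|z| on the circle that z |-> A z^n maps to the unit circle. For the coefficient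
    and degree of a composition it is [slog]. *)
Definition rate A n : R := n%:R^-1 * ln (normc A).

(** With L = [neglog], this is L(A z^n) = n (L(z) - [rate A n]), put as an implication between
    strict bounds so that z = 0 is covered without arithmetic on +oo. *)
Lemma neglog_monomial_gt A n p (c : R) : A != 0 -> (0 < n)%N ->
  (c%:E < neglog p)%E ->
  ((n%:R * (c - rate A n))%:E < neglog (monomial A n p))%E.
Proof.
rewrite -normc_gt0 => A0 n0; case: p => [z|//] /=.
rewrite !neglog_gt_fin => zc.
have n0' : n%:R != 0 :> R by rewrite pnatr_eq0 gtn_eqF.
have -> : - (n%:R * (c - rate A n)) = ln (normc A) + (- c) * n%:R.
  by rewrite /rate; field.
rewrite expRD lnK ?posrE// normcM normcX ltr_pM2l// expRM_natr.
by rewrite ltrXn2r ?gtn_eqF// ?nnegrE ?normc_ge0 ?expR_ge0.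
Qed.

(** Choose s < c1 < c2 < [neglog p]. Near p [neglog] exceeds c2, and eventually the rates are below
    c1, so the images have [neglog] above n_k (c2 - c1), which tends to +oo. The radius depends on
    c2 only, not on e. *)
Lemma cvg_monomial0 (A : nat -> R[i]) (n : nat -> nat) (s : \bar R) p :
    (forall k, A k != 0) -> (forall k, (0 < n k)%N) ->
    (forall M, exists N, forall k, (N <= k)%N -> (M <= n k)%N) ->
    (rate (A k) (n k))%:E @[k --> \oo] --> s -> (s < neglog p)%E ->
  exists2 r : R, 0 < r & forall e : R, 0 < e -> exists N : nat,
    forall k, (N <= k)%N -> forall q, sigma p q < r ->
      sigma (Some 0) (monomial (A k) (n k) q) < e.
Proof.
move=> A0 n0 noo cvs /ereal_dense[c1 sc1 /ereal_dense[c2]].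
rewrite lte_fin => c12 /neglog_gt_near[r r0 rP]; exists r => // e e0.
have [K KP] := sigma0_lt e0.
have [N1 _ N1P] : \forall k \near \oo, ((rate (A k) (n k))%:E < c1%:E)%E.
  exact: (cvs [set x | (x < c1%:E)%E] (open_ereal_lt' sc1)).
(* A degree of at least this Archimedean bound makes n_k (c2 - c1) at least K. *)
have [N2 N2P] := noo (Num.bound `|K / (c2 - c1)|).
exists (maxn N1 N2) => k; rewrite geq_max => /andP[/N1P /= + /N2P {}N2P] q.
rewrite lte_fin => sk /rP /(neglog_monomial_gt (A0 k) (n0 k)) h.
apply: KP; apply: le_lt_trans h; rewrite lee_fin.
have c120 : 0 < c2 - c1 by rewrite subr_gt0.
apply: (@le_trans _ _ ((n k)%:R * (c2 - c1))); last first.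
  by rewrite ler_wpM2l// lerD2l lerN2 ltW.
rewrite -ler_pdivrMr//; apply: (le_trans (ler_norm _)).
apply: le_trans (ltW (archi_boundP (normr_ge0 _))) _.
by rewrite ler_nat.
Qed.

Lemma rateV A n : A != 0 -> rate A^-1 n = - rate A n.
Proof. by rewrite -normc_gt0 => A0; rewrite /rate normcV lnV ?posrE// mulrN. Qed.

Lemma cvg_monomialy (A : nat -> R[i]) (n : nat -> nat) (s : \bar R) p :
    (forall k, A k != 0) -> (forall k, (0 < n k)%N) ->
    (forall M, exists N, forall k, (N <= k)%N -> (M <= n k)%N) ->
    (rate (A k) (n k))%:E @[k --> \oo] --> s -> (neglog p < s)%E ->
  exists2 r : R, 0 < r & forall e : R, 0 < e -> exists N : nat,
    forall k, (N <= k)%N -> forall q, sigma p q < r ->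
      sigma None (monomial (A k) (n k) q) < e.
Proof.
move=> A0 n0 noo cvs ps.
have [|||||r r0 rP] := @cvg_monomial0 (fun k => (A k)^-1) n (- s)%E
    (sphere_inv p).
- by move=> k; rewrite invr_eq0.
- exact: n0.
- exact: noo.
- under eq_fun do rewrite rateV// EFinN.
  exact: cvgeN.
- by rewrite neglog_inv lteN2.
exists r => // e /rP[N NP]; exists N => k /NP {}NP q.
rewrite -sigma_inv => /NP.
by rewrite -monomial_inv// -[in X in X -> _]sigma_inv sphere_invK /= eqxx.
Qed.

End Dynamics.

(** * Identification of the limits 0 and infinity *)

Section Limits.
Context {R : realType}.
Implicit Types (x : nat -> sphere R) (y : sphere R).

(** If y were not 0, a level c strictly between [neglog y] and +oo would separate the limits: the
    sequence would eventually satisfy both [neglog] < c and [neglog] > c. *)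
Lemma sigma_lim0 x y :
  (forall e : R, 0 < e -> exists N, forall k, (N <= k)%N ->
    sigma (Some 0) (x k) < e) ->
  (forall e : R, 0 < e -> exists N, forall k, (N <= k)%N ->
    sigma (x k) y < e) ->
  y = Some 0.
Proof.
move=> x0 xy; apply: neglog_eqy; apply/eqP/negP => /negP; rewrite -ltey.
move=> /ereal_dense[c yc cy].
have [r1 r10 r1P] := neglog_lt_near yc.
have [r2 r20 r2P] : exists2 r : R, 0 < r &
    forall q, sigma (Some 0) q < r -> (c%:E < neglog q)%E.
  by apply: neglog_gt_near; rewrite neglog0.
have [N1 N1P] := xy _ r10; have [N2 N2P] := x0 _ r20.
have := N1P _ (leq_maxl N1 N2); rewrite sigma_sym => /r1P h1.
have /r2P h2 := N2P _ (leq_maxr N1 N2).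
by have := lt_trans h1 h2; rewrite ltxx.
Qed.

Lemma sigma_limy x y :
  (forall e : R, 0 < e -> exists N, forall k, (N <= k)%N ->
    sigma None (x k) < e) ->
  (forall e : R, 0 < e -> exists N, forall k, (N <= k)%N ->
    sigma (x k) y < e) ->
  y = None.
Proof.
move=> xN xy; apply: (inv_inj sphere_invK).
apply: (@sigma_lim0 (fun k => sphere_inv (x k))) => e e0.
  have [N NP] := xN e e0; exists N => k /NP.
  by rewrite -sigma_inv.
have [N NP] := xy e e0; exists N => k /NP.
by rewrite -sigma_inv.
Qed.

End Limits.

(** * Compositions of the monomials and their Fatou set *)

Section MonomialSequence.
Context {R : realType}.
Context (a : nat -> R[i]) (d : nat -> nat).
Context (a_neq0 : forall n, (1 <= n)%N -> a n != 0).
Context (d_ge1 : forall n, (1 <= n)%N -> (1 <= d n)%N).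
Context (d_ge2 : forall N, exists n, (N <= n)%N /\ (2 <= d n)%N).

Let f n := monomial (a n) (d n).
(** The shift by one makes the sequence start with s_1. *)
Let S := accumulation_points (fun n => slog a d n.+1).

Lemma Dprod_gt0 n : (0 < Dprod d n)%N.
Proof.
by rewrite /Dprod big_nat; apply: prodn_cond_gt0 => i /andP[/d_ge1].
Qed.

Lemma DprodS n : Dprod d n.+1 = (Dprod d n * d n.+1)%N.
Proof. by rewrite /Dprod big_nat_recr. Qed.

Lemma Dprod_le m n : (m <= n)%N -> (Dprod d m <= Dprod d n)%N.
Proof.
move=> /subnK <-; elim: (n - m)%N => // k IH.
by rewrite addSn DprodS (leq_trans IH)// leq_pmulr// d_ge1.
Qed.

Lemma Dprod_dvd m n : (m <= n)%N -> (Dprod d m %| Dprod d n)%N.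
Proof.
by move=> /subnK <-; elim: (n - m)%N => // k IH; rewrite addSn DprodS dvdn_mulr.
Qed.

Lemma Dprod_unbounded M :
  exists N, forall n, (N <= n)%N -> (M <= Dprod d n)%N.
Proof.
elim: M => [|M [N NP]]; first by exists 0%N.
(* Asking for an index at least N+1 yields n+1 with n >= N; there a factor of at least 2 makes the
   product strictly larger than D_n >= M. *)
have [[|n] [Nn dn]] := d_ge2 N.+1; first by [].
exists n.+1 => m /Dprod_le; apply: leq_trans; rewrite DprodS.
by rewrite (leq_ltn_trans (NP n Nn))// ltn_Pmulr ?Dprod_gt0.
Qed.

Lemma Aprod_neq0 n : Aprod a d n != 0.
Proof.
rewrite /Aprod big_nat prodf_seq_neq0; apply/allP => i _; apply/implyP.
by move=> /andP[/a_neq0 ai _]; rewrite expf_neq0.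
Qed.

(** The new factor has exponent D/D = 1, and every other exponent is multiplied by d_{n+1}; the
    divisibility of the D_i makes this exact for the integer quotients. *)
Lemma AprodS n : Aprod a d n.+1 = a n.+1 * Aprod a d n ^+ d n.+1.
Proof.
rewrite /Aprod big_nat_recr//= divnn Dprod_gt0 expr1 mulrC; congr (_ * _).
rewrite -prodrXl !big_nat; apply: eq_bigr => i /andP[_ iN].
by rewrite -exprM DprodS divn_mulAC ?Dprod_dvd.
Qed.

Lemma composition_monomial n p :
  composition f n p = monomial (Aprod a d n) (Dprod d n) p.
Proof.
elim: n p => [|n IH] p.
  by rewrite /Aprod /Dprod !big_nat !big_nil; case: p => [z|//] /=; rewrite mul1r.
rewrite /= IH AprodS DprodS; case: p => [z|//] /=.
by rewrite exprMn -exprM mulrA.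
Qed.

(** A value outside S has an open neighbourhood that s_n eventually avoids, hence one disjoint from
    S; continuity of [neglog] pulls it back. *)
Lemma monomial_julia_open :
  sphere_open [set p : sphere R | ~ S (neglog p)].
Proof.
move=> p; rewrite /= /S => /accumulation_pointsP/existsNP[V /not_implyP[pV]].
move=> /existsNP[N NV]; have [r r0 rP] := neglog_continuous (nbhs_interior pV).
exists r => // q /rP qV /accumulation_pointsP /(_ _ qV N).
exact: NV.
Qed.

Lemma accumulation_points_along (n : nat -> nat) (s : \bar R) :
  (forall M, exists N, forall k, (N <= k)%N -> (M <= n k)%N) ->
  (slog a d (n k))%:E @[k --> \oo] --> s -> S s.
Proof.
move=> noo ns; apply/accumulation_pointsP => V /ns [N1 _ N1V] N.
(* The bound N+1 forces the index to be a successor m+1 with m >= N, as the shift in S demands. *)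
have [N2 N2P] := noo N.+1; have := N1V (maxn N1 N2) (leq_maxl _ _).
have /= := N2P _ (leq_maxr N1 N2); case: (n _) => [//|m] Nm Vm.
by exists m.
Qed.

(* A sequence of compositions either repeats one index infinitely often, and
   then has a constant subsequence, or its indices tend to infinity. *)
Lemma monomial_fatou_normal :
  normal_on [set p : sphere R | ~ S (neglog p)] (composition_family f).
Proof.
move=> g gf.
have /choice[n nP] : forall k, exists n, composition f n = g k.
  by move=> k; have [n _ <-] := gf k; exists n.
have [[m mP]|nm] := pselect (exists m, forall N, exists2 k, (N <= k)%N & n k = m).
  have [|phi phiS phiP] := @extract_subsequence (fun _ k => n k = m).
    by move=> _; exact: mP.
  exists phi, (monomial (Aprod a d m) (Dprod d m)); split=> //.
    by apply: holomorphic_monomial; [exact: Aprod_neq0|exact: Dprod_gt0].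
  move=> p _; exists 1 => // e e0; exists 0%N => k _ q _ _.
  by rewrite -nP phiP composition_monomial sigma_refl.
(* Induction on M: once the indices are at least M, the value M itself is taken only finitely
   often. *)
have noo M : exists N, forall k, (N <= k)%N -> (M <= n k)%N.
  elim: M => [|M [N NP]]; first by exists 0%N.
  have /existsNP[N' N'P] : ~ forall N, exists2 k, (N <= k)%N & n k = M.
    by move=> h; apply: nm; exists M.
  exists (maxn N N') => k; rewrite geq_max => /andP[/NP + N'k].
  rewrite leq_eqVlt => /predU1P[Mk|//].
  by exfalso; apply: N'P; exists k.
have [phi [s [phiS ns]]] :=
  ereal_bolzano_weierstrass (fun k => (slog a d (n k))%:E).
have nphi M : exists N, forall k, (N <= k)%N -> (M <= n (phi k))%N.
  have [N NP] := noo M; exists N => k Nk; apply: NP.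
  exact: leq_trans Nk (strictly_increasing_ge phiS k).
have Ss : S s := accumulation_points_along nphi ns.
have Dphi M : exists N, forall k, (N <= k)%N -> (M <= Dprod d (n (phi k)))%N.
  have [N NP] := Dprod_unbounded M; have [N' N'P] := nphi N.
  by exists N' => k /N'P /NP.
(* The remaining case s = [neglog p] cannot occur on the set considered, because s lies in S. *)
pose h p : sphere R := if (s < neglog p)%E then Some 0 else None.
have local p : ~ S (neglog p) -> exists2 r : R, 0 < r &
    (forall q, sigma p q < r -> h q = h p) /\
    forall e : R, 0 < e -> exists N : nat, forall k, (N <= k)%N ->
      forall q, sigma p q < r -> sigma (h p) (g (phi k) q) < e.
  have A0 k := Aprod_neq0 (n (phi k)); have D0 k := Dprod_gt0 (n (phi k)).
  move=> Sp; case: (ltgtP s (neglog p)) => [sp|ps|sp]; last by rewrite -sp in Sp.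
  - have [r1 r10 r1P] := neglog_continuous (open_ereal_gt' sp).
    have [r2 r20 r2P] := cvg_monomial0 A0 D0 Dphi ns sp.
    exists (Num.min r1 r2); first by rewrite lt_min r10.
    rewrite /h sp; split=> [q|e /r2P[N NP]].
      by rewrite lt_min => /andP[/r1P ->].
    exists N => k /NP {}NP q; rewrite lt_min => /andP[_ /NP].
    by rewrite -composition_monomial nP.
  - have [r1 r10 r1P] := neglog_continuous (open_ereal_lt' ps).
    have [r2 r20 r2P] := cvg_monomialy A0 D0 Dphi ns ps.
    exists (Num.min r1 r2); first by rewrite lt_min r10.
    rewrite /h [(s < neglog p)%E]ltNge (ltW ps); split=> [q|e /r2P[N NP]].
      by rewrite lt_min => /andP[/r1P/ltW + _]; rewrite leNgt => /negbTE ->.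
    exists N => k /NP {}NP q; rewrite lt_min => /andP[_ /NP].
    by rewrite -composition_monomial nP.
exists phi, h; split=> //.
  apply: holomorphic_locally_constant => p /local[r r0 [rP _]].
  by exists r.
move=> p /local[r r0 [rh rg]]; exists r => // e /rg[N NP].
by exists N => k /NP {}NP q _ pq; rewrite rh// sigma_sym; exact: NP.
Qed.

(* Along a subsequence with s_n -> -log|p|, a continuous limit would take both
   values 0 and infinity arbitrarily close to p, hence at p. *)
Lemma monomial_fatou_maximal U :
  sphere_open U -> normal_on U (composition_family f) ->
  U `<=` [set p : sphere R | ~ S (neglog p)].
Proof.
move=> Uo Un p Up [psi psiS psis].
have [|phi [h [phiS hol ch]]] := Un (fun k => composition f (psi k).+1).
  by move=> k; exists (psi k).+1.
have {hol}hc := (hol p Up).1.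
pose n k := (psi (phi k)).+1.
have nk k : (k <= n k)%N.
  apply: leqW; apply: leq_trans (strictly_increasing_ge phiS k) _.
  exact: strictly_increasing_ge.
have A0 k := Aprod_neq0 (n k); have D0 k := Dprod_gt0 (n k).
have Doo M : exists N, forall k, (N <= k)%N -> (M <= Dprod d (n k))%N.
  have [N NP] := Dprod_unbounded M; exists N => k Nk; apply: NP.
  exact: leq_trans (nk k).
have ns : (slog a d (n k))%:E @[k --> \oo] --> neglog p.
  move=> V /psis[N _ NV]; exists N => // k /= Nk; apply: NV => /=.
  exact: leq_trans Nk (strictly_increasing_ge phiS k).
have ptwise q : U q -> forall e : R, 0 < e -> exists N, forall k, (N <= k)%N ->
    sigma (monomial (Aprod a d (n k)) (Dprod d (n k)) q) (h q) < e.
  move=> Uq e e0; have [r r0 rP] := ch q Uq.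
  have [N NP] := rP e e0; exists N => k /NP /(_ q Uq).
  rewrite sigma_refl -composition_monomial; exact.
have [r0 r00 r0U] := Uo p Up.
have near0 (r : R) : 0 < r -> exists2 q, sigma p q < r & h q = Some 0.
  (* No point has [neglog] above +oo, but then p = 0 is fixed by all the monomials and is itself the
     required point. The case of -oo below is the same with infinity. *)
  move=> rgt0; have [py|py] := eqVneq (neglog p) +oo%E.
    exists p; first by rewrite sigma_refl.
    apply: (sigma_lim0 _ (ptwise p Up)) => e e0; exists 0%N => k _.
    by rewrite (neglog_eqy py) monomial0 ?sigma_refl.
  have [|q] := @exists_neglog_gt _ p (Num.min r0 r) _ py.
    by rewrite lt_min r00.
  rewrite lt_min => /andP[/r0U Uq pqr] pq; exists q => //.
  apply: (sigma_lim0 _ (ptwise q Uq)) => e e0.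
  have [r' r'0 /(_ e e0)[N NP]] := cvg_monomial0 A0 D0 Doo ns pq.
  by exists N => k /NP; apply; rewrite sigma_refl.
have neary (r : R) : 0 < r -> exists2 q, sigma p q < r & h q = None.
  move=> rgt0; have [py|py] := eqVneq (neglog p) -oo%E.
    exists p; first by rewrite sigma_refl.
    apply: (sigma_limy _ (ptwise p Up)) => e e0; exists 0%N => k _.
    by rewrite (neglog_eqNy py).
  have [|q] := @exists_neglog_lt _ p (Num.min r0 r) _ py.
    by rewrite lt_min r00.
  rewrite lt_min => /andP[/r0U Uq pqr] pq; exists q => //.
  apply: (sigma_limy _ (ptwise q Uq)) => e e0.
  have [r' r'0 /(_ e e0)[N NP]] := cvg_monomialy A0 D0 Doo ns pq.
  by exists N => k /NP; apply; rewrite sigma_refl.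
have : h p = Some 0.
  (* With a constant sequence the limit lemma says that a point at distance less than every e > 0
     from 0 is 0. *)
  apply: (@sigma_lim0 _ (fun _ => Some 0)) => e e0; exists 0%N => _ _.
    by rewrite sigma_refl.
  have [r rgt0 rP] := hc e e0; have [q pq hq] := near0 r rgt0.
  by rewrite sigma_sym -hq; exact: rP.
suff -> : h p = None by [].
apply: (@sigma_limy _ (fun _ => None)) => e e0; exists 0%N => _ _.
  by rewrite sigma_refl.
have [r rgt0 rP] := hc e e0; have [q pq hq] := neary r rgt0.
by rewrite sigma_sym -hq; exact: rP.
Qed.

End MonomialSequence.

Theorem theorem4p2 (R : realType) (a : nat -> R[i]) (d : nat -> nat)
    (a_neq0 : forall n, (1 <= n)%N -> a n != 0)
    (d_ge1 : forall n, (1 <= n)%N -> (1 <= d n)%N)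
    (d_ge2 : forall N, exists n, (N <= n)%N /\ (2 <= d n)%N) :
  is_julia_set (fun n => monomial (a n) (d n))
    (\bigcup_(s in accumulation_points (fun n => slog a d n.+1))
       [set z : sphere R | modulus z = expeR (- s)%E]).
Proof.
(* The complement of the circles becomes the set where [neglog] avoids S, the form used
   throughout. *)
rewrite /is_julia_set (_ : ~` _ = [set p : sphere R |
    ~ accumulation_points (fun n => slog a d n.+1) (neglog p)]); last first.
  apply/seteqP; split=> p /= H Sp; apply: H.
    by exists (neglog p) => //=; apply/modulus_expeR.
  by case: Sp => s Ss /= /modulus_expeR <-.
split; first exact: monomial_julia_open.
- exact: monomial_fatou_normal.
- exact: monomial_fatou_maximal.
Qed.
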